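(* Let $T$ be a finite tree and $v$ a vertex of $T$. Then $$3(N_{T}R_{v}-N_{v}R_{T})\ge N_{T}^{2}-N_{v}N_{T},$$ which is equivalent to $$\mu_{T}(v)-\mu_{T}\ge\frac{1}{3}\left(\frac{N_{T}}{N_{v}}-1\right).$$
   Context: A subtree of a tree $T$ is a nonempty connected subgraph of $T$ (single vertices and $T$ itself are included); its order (cardinality) is its number of vertices. $N_T$ is the number of subtrees of $T$ and $R_T$ is the sum of the orders of all subtrees of $T$. $N_v$ is the number of subtrees of $T$ containing the vertex $v$, and $R_v$ is the sum of the orders of all subtrees of $T$ containing $v$. The global mean is $\mu_T = R_T/N_T$ (average order of all subtrees) and the local mean at $v$ is $\mu_T(v)=R_v/N_v$ (average order of the subtrees containing $v$). *)

(* Defs.v *)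
From HB Require Import structures.
From mathcomp Require Import all_boot all_order all_algebra.
Set Implicit Arguments.
Unset Strict Implicit.
Unset Printing Implicit Defensive.
Import Order.TTheory GRing.Theory Num.Theory.
Local Open Scope ring_scope.

Record sgraph (V : finType) := SGraph {
  adj :> rel V;
  adj_sym : symmetric adj;
  adj_irr : irreflexive adj }.

(* [ucycle] also accepts [:: x; y] for an edge xy, traversed back and forth;
   genuine cycles have at least three vertices. *)
Definition acyclic (V : finType) (G : sgraph V) : Prop :=
  forall c : seq V, ucycle G c -> (size c <= 2)%N.

Definition connected (V : finType) (G : sgraph V) : Prop :=
  forall x y : V, connect G x y.

Definition is_tree (V : finType) (T : sgraph V) : Prop :=
  [/\ (0 < #|V|)%N, connected T & acyclic T].

Definition edges (V : finType) (G : sgraph V) : {set {set V}} :=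
  [set [set x; y] | x in V, y in G x].

(* A pair H stands for the graph with vertex set H.1 and edge set H.2. *)
Definition is_subgraph (V : finType) (G : sgraph V)
    (H : {set V} * {set {set V}}) : bool :=
  (H.2 \subset edges G) && [forall f in H.2, f \subset H.1].

Definition pair_connected (V : finType) (H : {set V} * {set {set V}}) : bool :=
  [forall x in H.1, forall y in H.1,
    connect [rel a b | [set a; b] \in H.2] x y].

Definition subtrees (V : finType) (T : sgraph V) :
    {set {set V} * {set {set V}}} :=
  [set H | [&& is_subgraph T H, H.1 != set0 & pair_connected H]].

Definition subtrees_at (V : finType) (T : sgraph V) (v : V) :
    {set {set V} * {set {set V}}} :=
  [set H in subtrees T | v \in H.1].

Definition NT (V : finType) (T : sgraph V) : nat := #|subtrees T|.

Definition RT (V : finType) (T : sgraph V) : nat :=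
  (\sum_(H in subtrees T) #|H.1|)%N.

Definition Nv (V : finType) (T : sgraph V) (v : V) : nat :=
  #|subtrees_at T v|.

Definition Rv (V : finType) (T : sgraph V) (v : V) : nat :=
  (\sum_(H in subtrees_at T v) #|H.1|)%N.

Definition global_mean (V : finType) (T : sgraph V) : rat :=
  (RT T)%:R / (NT T)%:R.

Definition local_mean (V : finType) (T : sgraph V) (v : V) : rat :=
  (Rv T v)%:R / (Nv T v)%:R.

(* Main.v *)
Require Import Defs.
From HB Require Import structures.
From mathcomp Require Import all_boot all_order all_algebra.
From mathcomp Require Import ring lra.
Set Implicit Arguments.
Unset Strict Implicit.
Unset Printing Implicit Defensive.
Import Order.TTheory GRing.Theory Num.Theory.
Local Open Scope ring_scope.

(** A subtree of a tree is determined by its vertex set, which can be any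
    nonempty connected set of vertices ([subtree_induced],
    [induced_subgraph_subtree]).  So it is enough to count connected vertex
    sets, and this is done for every connected part [U] of the tree, with every
    choice of root [v] in [U], by induction on the size of [U].

    Unless [U] is a single vertex, choose an edge [vw] inside [U].  As there
    are no cycles, removing it splits [U] into a side [A] containing [v] and a
    side [B] containing [w] ([bridge_exists]).  A connected subset of [U] lies
    in [A], or lies in [B], or is the union of one connected subset of [A]
    through [v] and one connected subset of [B] through [w] ([connected_setsU]).
    Write [n, r] for the number and total size of the connected subsets
    through the root, and [N, R] for those of all connected subsets; if these
    numbers are [a, s, x, X] for [A] at [v] and [b, q, y, Y] for [B] at [w],
    then for [U] at [v]
<<
      n = a (1 + b)             r = s (1 + b) + a q
      N = x + y + a b           R = X + Y + s b + a q
>>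
    It remains to see that [3 (N r - n R) >= N^2 - n N] passes from [A] and
    [B] to [U].  Substituting, [b] times the difference of the two sides is
    [b (1 + b)] times that of [A], plus [a (1 + b)] times that of [B], plus a
    remainder free of [X] and [Y].  The remainder is nonnegative because of
    the bound [3 q <= y + b (b + 1)], which is an equality when [B] is a path
    rooted at an end.  That bound does not propagate by itself, but does
    together with [2 q <= b (b + 1)].  These inequalities, with a few trivial
    ones, form the invariant [rooted_bounds]; its propagation along an edge is
    [rooted_bounds_graft]. *)

(** * Inequalities between the counts of a rooted tree *)

(** The arguments stand for the number and total order of the subtrees through
    the root, and the number and total order of all subtrees. *)
Record rooted_bounds (F : realFieldType) (n r N R : F) : Prop := RootedBounds {
  rb_le_r : n <= r;
  rb_le_N : n <= N;
  (* Either the tree is its root alone, or the root has a neighbour. *)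
  rb_root_or_ge2 : n = 1 /\ N = 1 \/ 2 <= n;
  rb_upper2 : 2 * r <= n * (n + 1);
  rb_upper3 : 3 * r <= N + n * (n + 1);
  rb_main : N ^+ 2 - n * N <= 3 * (N * r - n * R) }.

Lemma rooted_bounds1 (F : realFieldType) : rooted_bounds (1 : F) 1 1 1.
Proof. by split; [| |left| | |]; lra. Qed.

Lemma rb_ge1 (F : realFieldType) (n r N R : F) : rooted_bounds n r N R -> 1 <= n.
Proof. by case=> _ _ [[-> _]|n2] _ _ _ //; lra. Qed.

(** Each bound for the tree obtained by joining the two roots by an edge is a
    combination, with nonnegative coefficients, of the bounds for the two
    parts and of evidently nonnegative terms. *)
Lemma rooted_bounds_graft (F : realFieldType) (a s x X b q y Y : F) :
    rooted_bounds a s x X -> rooted_bounds b q y Y ->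
  rooted_bounds (a * (1 + b)) (s * (1 + b) + a * q)
    (x + y + a * b) (X + Y + (s * b + a * q)).
Proof.
move=> hA hB; have a1 := rb_ge1 hA; have b1 := rb_ge1 hB.
case: hA hB => as_ ax at_ a2 a3 aM [bq by_ _ b2 b3 bM].
have ab1 : 1 <= a * b by rewrite mulr_ege1.
have a0 : 0 <= a by lra.
have b0 : 0 <= b by lra.
have q0 : 0 <= q by lra.
have y0 : 0 <= y by lra.
have b10 : 0 <= 1 + b by lra.
split.
- by rewrite (le_trans (ler_wpM2r b10 as_)) // lerDl mulr_ge0.
- lra.
- by right; lra.
- rewrite -subr_ge0.
  have h1 : 0 <= (1 + b) * (a * (a + 1) - 2 * s) by rewrite mulr_ge0 ?subr_ge0.
  have h2 : 0 <= a * (b * (b + 1) - 2 * q) by rewrite mulr_ge0 ?subr_ge0.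
  have h3 : 0 <= a * (1 + b) * (b * (a - 1)) by rewrite !mulr_ge0 ?subr_ge0.
  rewrite [leRHS](_ : _ = (1 + b) * (a * (a + 1) - 2 * s)
    + a * (b * (b + 1) - 2 * q) + a * (1 + b) * (b * (a - 1))); last by ring.
  by rewrite !addr_ge0.
- (* Use the bound on 3 r once for each part, and the bound on 2 r for the
     remaining b copies of s and a - 1 copies of q: the first is sharp for
     paths, the second can be multiplied by b or a - 1 without producing
     multiples of x or y that N could not pay for. *)
  have h1 : 0 <= b * (a * (a + 1) - 2 * s) by rewrite mulr_ge0 ?subr_ge0.
  have h2 : 0 <= (a - 1) * (b * (b + 1) - 2 * q) by rewrite mulr_ge0 ?subr_ge0.
  have h3 : 0 <= b * (a - 1) ^+ 2 by rewrite mulr_ge0 ?sqr_ge0.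
  have h4 : 0 <= b ^+ 2 * ((a - 1) * (2 * a - 1)).
    by rewrite !mulr_ge0 ?sqr_ge0 ?subr_ge0 //; lra.
  lra.
- have b_gt0 : 0 < b by lra.
  rewrite -subr_ge0 -(pmulr_rge0 _ b_gt0).
  have h1 : 0 <= b * (1 + b) * (3 * (x * s - a * X) - (x ^+ 2 - a * x)).
    by rewrite !mulr_ge0 ?subr_ge0.
  have h2 : 0 <= a * (1 + b) * (3 * (y * q - b * Y) - (y ^+ 2 - b * y)).
    by rewrite !mulr_ge0 ?subr_ge0.
  have h3 : 0 <= a * b * (q - b) * (x - a) by rewrite !mulr_ge0 ?subr_ge0.
  have h4 : 0 <= y * b * (1 + b) * (s - a) by rewrite !mulr_ge0 ?subr_ge0.
  have h5 : 0 <= a * y * (y + b * (b + 1) - 3 * q).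
    by rewrite !mulr_ge0 ?subr_ge0.
  have h6 : 0 <= b * (a * b * (x - a)) by rewrite !mulr_ge0 ?subr_ge0.
  (* The one indefinite term, a quadratic form in y and x - a: its
     discriminant has the right sign once a >= 2, and x = a when a = 1. *)
  have h7 : 0 <= b * ((a - 1) * y ^+ 2 + b * (x - a) ^+ 2 - 2 * (x - a) * y).
    rewrite mulr_ge0 //; case: at_ => [[-> ->]|a_ge2].
      by rewrite !subrr expr0n /= !(mulr0, mul0r) !addr0 subr0.
    rewrite [leRHS](_ : _ = (a - 2) * y ^+ 2 + (b - 1) * (x - a) ^+ 2
      + (y - (x - a)) ^+ 2); last by ring.
    have [a2_ge0 b1_ge0] : 0 <= a - 2 /\ 0 <= b - 1 by rewrite !subr_ge0.
    by do ?[exact: sqr_ge0 | assumption | apply: addr_ge0 | apply: mulr_ge0].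
  rewrite [leRHS](_ : _ =
      b * (1 + b) * (3 * (x * s - a * X) - (x ^+ 2 - a * x))
    + a * (1 + b) * (3 * (y * q - b * Y) - (y ^+ 2 - b * y))
    + 3 * (a * b * (q - b) * (x - a)) + 3 * (y * b * (1 + b) * (s - a))
    + a * y * (y + b * (b + 1) - 3 * q) + 3 * (b * (a * b * (x - a)))
    + b * ((a - 1) * y ^+ 2 + b * (x - a) ^+ 2 - 2 * (x - a) * y));
    last by ring.
  by do ?[assumption | apply: addr_ge0 | apply: (mulr_ge0 (ler0n _ _))].
Qed.

(** * Connected vertex sets and bridges *)

Section Subtrees.
Variables (V : finType) (G : sgraph V).
Implicit Types (S A B U : {set V}) (u v w x y : V)
  (H : {set V} * {set {set V}}).

Definition induced S : rel V := [rel x y | [&& x \in S, y \in S & G x y]].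

Definition connected_in S : bool :=
  [forall x in S, forall y in S, connect (induced S) x y].

Lemma induced_sym S : symmetric (induced S).
Proof. by move=> x y; rewrite /induced /= adj_sym andbCA. Qed.

Lemma connect_induced_sym S : connect_sym (induced S).
Proof. exact/sym_connect_sym/induced_sym. Qed.

Lemma connected_inP S :
  reflect {in S &, forall x y, connect (induced S) x y} (connected_in S).
Proof.
apply: (iffP forall_inP) => [h x y xS yS|h x xS].
  by move/forall_inP: (h x xS); apply.
by apply/forall_inP => y; apply: h.
Qed.

(** Connectivity is used below in this form: choose a property [X] that edges
    inside [S] preserve, so that it spreads from one point to all of [S]. *)
Lemma connect_induced_inv S (X : {pred V}) :
    {in S &, forall a b, G a b -> a \in X -> b \in X} ->
  forall x y, connect (induced S) x y -> x \in X -> y \in X.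
Proof.
move=> h x y /connectP[p + ->]; elim: p x => //= a p IH x.
by case/andP=> /and3P[xS aS xa] pa xX; apply: IH pa (h x a xS aS xa xX).
Qed.

Lemma connected_in_from x S :
  {in S, forall y, connect (induced S) x y} -> connected_in S.
Proof.
move=> h; apply/connected_inP => y z yS zS.
by apply: connect_trans (h _ zS); rewrite connect_induced_sym h.
Qed.

Lemma connected_in1 x : connected_in [set x].
Proof. by apply: (connected_in_from (x := x)) => y /set1P ->. Qed.

Lemma connect_induced_mono A B x y :
  A \subset B -> connect (induced A) x y -> connect (induced B) x y.
Proof.
move=> sAB; apply: connect_sub => u v /and3P[uA vA uv].
by rewrite connect1 // /induced /= !(subsetP sAB) ?uv.
Qed.

(** The edge [vw] is the only one between the disjoint sets [A] and [B], on
    whose union [U] the induced graph is thus cut in two by removing [vw]. *)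
Definition bridge A B v w : Prop :=
  [/\ [disjoint A & B], v \in A, w \in B, G v w
    & {in A & B, forall x y, G x y -> x = v /\ y = w}].

Lemma bridge_sym A B v w : bridge A B v w -> bridge B A w v.
Proof.
case=> dAB vA wB vw h; split; rewrite ?(disjoint_sym B) // ?(adj_sym _ w) //.
by move=> x y xB yA; rewrite adj_sym => /(h _ _ yA xB)[].
Qed.

(** A connected set that meets both sides crosses from [A] to [B] somewhere,
    and an edge that does so starts at [v]. *)
Lemma connected_in_bridge_end A B v w S : bridge A B v w ->
    S \subset A :|: B -> connected_in S -> ~~ (S \subset A) -> ~~ (S \subset B) ->
  v \in S.
Proof.
move=> [dAB vA wB vw h] sU /connected_inP cS /subsetPn[y yS yA] /subsetPn[x xS xB].
have {}xA : x \in A by move: (subsetP sU x xS); rewrite inE (negPf xB) orbF.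
apply: contraT => vS.
rewrite -(negPf yA).
apply: connect_induced_inv (cS x y xS yS) xA => a b aS bS ab aA.
apply: contraT => bA; have bB : b \in B.
  by move: (subsetP sU b bS); rewrite inE (negPf bA).
by have [av _] := h a b aA bB ab; rewrite -av aS in vS.
Qed.

(** A walk inside [S] from [v] that leaves [A] can come back only through [v]:
    being in [B] or reachable from [v] inside [S :&: A] is preserved along
    the edges of [S]. *)
Lemma connected_in_bridgeI A B v w S : bridge A B v w ->
  S \subset A :|: B -> connected_in S -> v \in S -> connected_in (S :&: A).
Proof.
move=> [dAB vA wB vw h] sU /connected_inP cS vS.
apply: (connected_in_from (x := v)) => x.
case/setIP=> xS xA; set e := induced (S :&: A).
pose X := [pred u | (u \in B) || connect e v u].
have: x \in X.
  apply: connect_induced_inv (cS v x vS xS) _; last by rewrite !inE connect0 orbT.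
  move=> a b aS bS ab; rewrite !inE.
  have [//|bB] /= := boolP (b \in B).
  have bA : b \in A by move: (subsetP sU b bS); rewrite inE (negPf bB) orbF.
  have [aB _|aB va] /= := boolP (a \in B).
    by rewrite adj_sym in ab; have [-> _] := h b a bA aB ab.
  have aA : a \in A by move: (subsetP sU a aS); rewrite inE (negPf aB) orbF.
  by apply: connect_trans va (connect1 _); rewrite /e /induced /= !inE aS aA bS bA.
by rewrite !inE (disjointFr dAB xA).
Qed.

Lemma connected_in_bridgeU A B v w S1 S2 : bridge A B v w ->
  v \in S1 -> w \in S2 ->
  connected_in S1 -> connected_in S2 -> connected_in (S1 :|: S2).
Proof.
move=> [_ _ _ vw _] v1 w2 /connected_inP c1 /connected_inP c2.
apply: (connected_in_from (x := v)) => x /setUP[x1|x2].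
  exact: connect_induced_mono (subsetUl _ _) (c1 _ _ v1 x1).
apply: connect_trans (connect_induced_mono (subsetUr _ _) (c2 _ _ w2 x2)).
by apply: connect1; rewrite /induced /= !inE v1 w2 orbT.
Qed.

(** Otherwise a shortest walk from [x] to [y] in [e] would close up with the
    edge [xy] to a cycle of length at least three. *)
Lemma acyclic_connect (e : rel V) x y :
  acyclic G -> subrel e G -> connect e x y -> G x y -> e x y.
Proof.
move=> acG sub /connectP[p ep yE]; move: yE; case/shortenP: ep => q eq uq _ yE xy.
have: (size (x :: q) <= 2)%N.
  apply: acG; rewrite /ucycle uq andbT /cycle rcons_path (sub_path sub eq) -yE.
  by rewrite adj_sym.
case: q eq uq yE => [|z [|//]] /= eq uq yE _.
  by rewrite yE adj_irr in xy.
by rewrite andbT -yE in eq.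
Qed.

(** [B] is the component of a neighbour [w] of [v] in [U] minus [v]; an edge
    of [U] leaving [B] ends at [v], and there is only one because a second edge from
    [v] to [B] would close a cycle. *)
Lemma bridge_exists U v : acyclic G -> connected_in U -> v \in U -> U != [set v] ->
  exists A B w, U = A :|: B /\ bridge A B v w.
Proof.
move=> acG /connected_inP cU vU Uv.
have [x xU xv] : exists2 x, x \in U & x != v.
  apply/exists_inP; apply: contraNT Uv => /exists_inPn h.
  rewrite eqEsubset sub1set vU andbT; apply/subsetP => x xU.
  by have := h x xU; rewrite negbK inE.
have [w wU vw] : exists2 w, w \in U & G v w.
  have /connectP[[|w p] /= ep xE] := cU v x vU xU; first by rewrite xE eqxx in xv.
  by case/andP: ep => /and3P[_ wU vw] _; exists w.
have wv : w != v by apply: contraTneq vw => ->; rewrite adj_irr.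
set e := induced (U :\ v).
have eW u : connect e w u -> u \in U :\ v.
  by move/connect_induced_inv; apply=> [a b _ ->|]; rewrite // !inE wv.
pose B := [set u | connect e w u].
have sBU : B \subset U by apply/subsetP => u; rewrite inE => /eW /setD1P[].
exists (U :\: B), B, w; split; first by rewrite setUC -{1}(setIidPr sBU) setID.
have vB : v \notin B by rewrite inE; apply/negP => /eW; rewrite !inE eqxx.
split=> //.
- rewrite disjoint_sym disjoints_subset; apply/subsetP => u uB.
  by rewrite in_setC in_setD uB.
- by rewrite in_setD vB.
- by rewrite inE connect0.
move=> a b /setDP[aU aB]; rewrite inE => wb ab.
have {aB} av : a = v.
  apply/eqP; apply: contraNT aB => av; rewrite inE.
  apply: (connect_trans wb (connect1 _)).
  have /setD1P[bv bU] := eW b wb.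
  by rewrite /e /induced /= !inE av aU bv bU adj_sym.
subst a; split=> //.
(* If b were not w, the edge vb would be a shortcut for the walk that goes
   from v to w and then inside U minus v. *)
pose ew := [rel c d | e c d || (c == v) && (d == w)].
have: ew v b.
  apply: (acyclic_connect (e := ew) acG) ab => [c d /=|].
    by case/orP=> [/and3P[]|/andP[/eqP-> /eqP->]].
  apply: (@connect_trans _ _ w); first by apply: connect1; rewrite /= !eqxx orbT.
  by apply: connect_sub wb => c d cd; apply: connect1; rewrite /= cd.
by rewrite /= /e /induced /= !inE eqxx /= => /eqP.
Qed.

(** * Counting connected sets across a bridge *)

Definition connected_sets U : {set {set V}} :=
  [set S : {set V} | [&& S \subset U, S != set0 & connected_in S]].

Definition connected_sets_at U v : {set {set V}} :=
  [set S in connected_sets U | v \in S].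

(** A connected set that lies in neither side contains both [v] and [w], and its
    traces on the two sides are connected; conversely the edge [vw] connects
    any two connected sets through its ends. *)
Lemma connected_setsU A B v w : bridge A B v w ->
  connected_sets (A :|: B) = connected_sets A :|: connected_sets B
    :|: [set S1 :|: S2 | S1 in connected_sets_at A v, S2 in connected_sets_at B w].
Proof.
move=> br; have rb := bridge_sym br; have [dAB vA wB vw h] := br.
apply/setP => S; rewrite !inE; apply/idP/idP.
  case/and3P=> sU S0 cS; rewrite S0 cS !andbT.
  have [//|sA] := boolP (S \subset A); have [//|sB] := boolP (S \subset B) => /=.
  have vS := connected_in_bridge_end br sU cS sA sB.
  have cA := connected_in_bridgeI br sU cS vS.
  move: (sU); rewrite setUC => sU'.
  have wS := connected_in_bridge_end rb sU' cS sB sA.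
  have cB := connected_in_bridgeI rb sU' cS wS.
  apply/imset2P; exists (S :&: A) (S :&: B).
  - rewrite !inE subsetIr cA vS vA !andbT; apply/set0Pn; exists v; exact/setIP.
  - rewrite !inE subsetIr cB wS wB !andbT; apply/set0Pn; exists w; exact/setIP.
  - by rewrite -setIUr (setIidPl sU).
case/orP=> [/orP[|] /and3P[sS -> ->]|].
- by rewrite subsetU ?sS.
- by rewrite subsetU ?sS ?orbT.
case/imset2P=> S1 S2; rewrite !inE => /andP[/and3P[s1 _ c1] v1].
case/andP=> /and3P[s2 _ c2] w2 ->.
rewrite setUSS // (connected_in_bridgeU br) // andbT /=.
by apply/set0Pn; exists v; rewrite inE v1.
Qed.

Lemma sum_setU (I : finType) (D E : {set I}) (F : I -> nat) :
  [disjoint D & E] ->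
  (\sum_(i in D :|: E) F i = \sum_(i in D) F i + \sum_(i in E) F i)%N.
Proof. by move=> dDE; rewrite -bigU //; apply: eq_bigl => i; rewrite !inE. Qed.

(** The three families of [connected_setsU] are disjoint, and a set crossing the
    bridge determines its two traces on [A] and [B].  The weight [f] will be the
    constant 1 or the cardinal. *)
Lemma sum_connected_setsU A B v w (f : {set V} -> nat) : bridge A B v w ->
  (\sum_(S in connected_sets (A :|: B)) f S = \sum_(S in connected_sets A) f S
    + \sum_(S in connected_sets B) f S
    + \sum_(S1 in connected_sets_at A v)
        \sum_(S2 in connected_sets_at B w) f (S1 :|: S2))%N.
Proof.
move=> br; have [dAB vA wB vw h] := br; rewrite (connected_setsU br).
set C := [set _ | _ in _, _ in _].
have dABC : [disjoint connected_sets A :|: connected_sets B & C].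
  rewrite disjoint_subset; apply/subsetP => S; rewrite !inE => SAB.
  apply/negP => /imset2P[S1 S2]; rewrite !inE => /andP[_ v1] /andP[_ w2] SE.
  case/orP: SAB => /and3P[/subsetP sS _ _].
    by have := sS w; rewrite SE inE w2 orbT (disjointFl dAB wB) => /(_ isT).
  by have := sS v; rewrite SE inE v1 (disjointFr dAB vA) => /(_ isT).
have dAB' : [disjoint connected_sets A & connected_sets B].
  rewrite disjoint_subset; apply/subsetP => S; rewrite !inE => /and3P[sA S0 _].
  apply/negP => /and3P[sB _ _]; case/set0Pn: S0 => x xS.
  by have := subsetP sB x xS; rewrite (disjointFr dAB (subsetP sA x xS)).
rewrite !sum_setU //; congr (_ + _)%N.
rewrite /C curry_imset2X big_imset /=; last first.
  case=> S1 S2 [S1' S2']; rewrite !inE /= => /andP[/andP[/and3P[s1 _ _] _]].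
  case/andP=> /and3P[s2 _ _] _ /andP[/andP[/and3P[t1 _ _] _]].
  case/andP=> /and3P[t2 _ _] _ E.
  have eA (X Y : {set V}) : X \subset A -> Y \subset B -> (X :|: Y) :&: A = X.
    move=> sX sY; rewrite setIUl (setIidPl sX); apply/setUidPl.
    by rewrite (disjoint_setI0 (disjointWl sY _)) ?sub0set // disjoint_sym.
  have eB (X Y : {set V}) : X \subset A -> Y \subset B -> (X :|: Y) :&: B = Y.
    move=> sX sY; rewrite setIUl (setIidPl sY); apply/setUidPr.
    by rewrite (disjoint_setI0 (disjointWl sX _)) ?sub0set.
  by rewrite -(eA S1 S2) // -{2}(eB S1 S2) // E eA ?eB.
by rewrite pair_big /=; apply: eq_big => -[S1 S2] //; rewrite inE.
Qed.

Lemma sum_connected_sets_at U v (f : {set V} -> nat) :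
  (\sum_(S in connected_sets_at U v) f S
    = \sum_(S in connected_sets U) if v \in S then f S else 0)%N.
Proof.
by rewrite -big_mkcondr; apply: eq_bigl => S; rewrite inE.
Qed.

Lemma sum_connected_sets_atU A B v w (f : {set V} -> nat) : bridge A B v w ->
  (\sum_(S in connected_sets_at (A :|: B) v) f S
    = \sum_(S in connected_sets_at A v) f S
    + \sum_(S1 in connected_sets_at A v)
        \sum_(S2 in connected_sets_at B w) f (S1 :|: S2))%N.
Proof.
move=> br; have [dAB vA wB vw h] := br.
rewrite sum_connected_sets_at (sum_connected_setsU _ br).
rewrite -sum_connected_sets_at -addnA.
congr (_ + _)%N.
rewrite big1 ?add0n => [|S].
  apply: eq_bigr => S1; rewrite inE => /andP[_ v1].
  by apply: eq_bigr => S2 _; rewrite inE v1.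
rewrite inE => /and3P[sB _ _]; case: ifP => // vS.
by have := subsetP sB v vS; rewrite (disjointFr dAB vA).
Qed.

Lemma sum_connected_sets1 v (f : {set V} -> nat) :
  (\sum_(S in connected_sets [set v]) f S = f [set v])%N.
Proof.
rewrite -[RHS](big_set1 addn); apply: eq_bigl => S; rewrite !inE subset1.
case: eqP => [->|_] /=; last by case: eqP.
by rewrite connected_in1 andbT; apply/set0Pn; exists v; rewrite inE.
Qed.

(** Induction on the size of [U], cutting along a bridge at [v].  The sums over
    the sets crossing the bridge factor, since such a set is an arbitrary pair
    of disjoint traces; this gives the recursion of [rooted_bounds_graft]. *)
Lemma connected_sets_rooted_bounds U v : acyclic G -> connected_in U -> v \in U ->
  rooted_bounds (F := rat) (\sum_(S in connected_sets_at U v) 1)%:R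
   (\sum_(S in connected_sets_at U v) #|S|)%:R
   (\sum_(S in connected_sets U) 1)%:R
   (\sum_(S in connected_sets U) #|S|)%:R.
Proof.
move=> acG; have [m] := ubnP #|U|; elim: m U v => // m IH U v /ltnSE leUm cU vU.
have [->|Uv] := eqVneq U [set v].
  rewrite !sum_connected_sets_at !sum_connected_sets1 inE eqxx cards1.
  exact: rooted_bounds1.
have [A [B [w [UE br]]]] := bridge_exists acG cU vU Uv; subst U.
have [dAB vA wB _ _] := br.
have cardU : #|A :|: B| = (#|A| + #|B|)%N.
  by rewrite cardsU (disjoint_setI0 dAB) cards0 subn0.
have A0 : (0 < #|A|)%N by apply/card_gt0P; exists v.
have B0 : (0 < #|B|)%N by apply/card_gt0P; exists w.
have wU : w \in A :|: B by rewrite inE wB orbT.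
have cA : connected_in A.
  by have := connected_in_bridgeI br (subxx _) cU vU; rewrite setUK.
have cB : connected_in B.
  rewrite setUC in cU wU.
  by have := connected_in_bridgeI (bridge_sym br) (subxx _) cU wU; rewrite setUK.
have hA : (#|A| < m)%N.
  by apply: leq_trans leUm; rewrite cardU -[X in (X < _)%N]addn0 ltn_add2l.
have hB : (#|B| < m)%N.
  by apply: leq_trans leUm; rewrite cardU -[X in (X < _)%N]add0n ltn_add2r.
have := rooted_bounds_graft (IH A v hA cA vA) (IH B w hB cB wB).
have cross1 : (\sum_(S1 in connected_sets_at A v)
      \sum_(S2 in connected_sets_at B w) 1
    = (\sum_(S1 in connected_sets_at A v) 1)
        * \sum_(S2 in connected_sets_at B w) 1)%N.
  by rewrite big_distrl /=; apply: eq_bigr => S1 _; rewrite mul1n.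
have crossC : (\sum_(S1 in connected_sets_at A v)
      \sum_(S2 in connected_sets_at B w) #|S1 :|: S2|
    = (\sum_(S1 in connected_sets_at A v) #|S1|)
        * (\sum_(S2 in connected_sets_at B w) 1)
      + (\sum_(S1 in connected_sets_at A v) 1)
        * \sum_(S2 in connected_sets_at B w) #|S2|)%N.
  rewrite !big_distrl -big_split /=; apply: eq_bigr => S1; rewrite !inE.
  case/andP=> /and3P[s1 _ _] _; rewrite mul1n big_distrr -big_split /=.
  apply: eq_bigr => S2; rewrite !inE => /andP[/and3P[s2 _ _] _].
  rewrite muln1 cardsU (_ : S1 :&: S2 = set0) ?cards0 ?subn0 //.
  by apply: disjoint_setI0; apply: disjointW dAB.
rewrite !(sum_connected_setsU _ br) !(sum_connected_sets_atU _ br) cross1 crossC.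
rewrite !natrD !natrM !mulrDr !mulr1.
congr (rooted_bounds _ _ _ _); ring.
Qed.

(** * Subtrees as connected vertex sets *)

Lemma in_edges x y : ([set x; y] \in edges G) = G x y.
Proof.
apply/imset2P/idP => [[a b _ ab E]|xy]; last by exists x y.
have {}ab : G a b := ab.
have ab' : a != b by apply: contraTneq ab => ->; rewrite adj_irr.
have := set21 x y; rewrite E => /set2P[] xE;
  have := set22 x y; rewrite E => /set2P[] yE.
- by move: (set22 a b); rewrite -E xE yE setUid inE eq_sym (negPf ab').
- by rewrite xE yE.
- by rewrite xE yE adj_sym.
- by move: (set21 a b); rewrite -E xE yE setUid inE (negPf ab').
Qed.

Definition induced_subgraph S : {set V} * {set {set V}} :=
  (S, edges G :&: powerset S).

Lemma induced_subgraph_adj S x y :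
  [set x; y] \in (induced_subgraph S).2 = induced S x y.
Proof. by rewrite inE in_edges inE subUset !sub1set andbC -andbA. Qed.

Lemma induced_subgraph_subtree S :
  (induced_subgraph S \in subtrees G) = (S != set0) && connected_in S.
Proof.
rewrite inE /is_subgraph subsetIl /=.
have -> /= : [forall f in (induced_subgraph S).2, f \subset S].
  by apply/forall_inP => f; rewrite !inE => /andP[].
congr andb.
apply: eq_forallb_in => x _; apply: eq_forallb_in => y _.
by apply: eq_connect => a b; rewrite -induced_subgraph_adj.
Qed.

(** An edge of the tree between two vertices of [H] belongs to [H], as [H]
    already connects them. *)
Lemma subtree_induced H : acyclic G -> H \in subtrees G -> H = induced_subgraph H.1.
Proof.
case: H => S F acG; rewrite inE => /and3P[/andP[/= sF inF] _ cF].
congr pair; apply/eqP; rewrite eqEsubset; apply/andP; split.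
  by apply/subsetP => f fF; rewrite !inE (subsetP sF) //= (forall_inP inF).
apply/subsetP => f; rewrite !inE => /andP[/imset2P[x y _ xy ->] sS].
have [xS yS] : x \in S /\ y \in S by apply/andP; rewrite -!sub1set -subUset.
apply: (acyclic_connect (e := [rel a b | [set a; b] \in F]) acG) xy => [a b /=|].
  by move/(subsetP sF); rewrite in_edges.
exact: forall_inP (forall_inP cF x xS) y yS.
Qed.

Lemma sum_subtrees (P : pred {set V}) (f : {set V} -> nat) : acyclic G ->
  (\sum_(H in subtrees G | P H.1) f H.1
    = \sum_(S in connected_sets setT | P S) f S)%N.
Proof.
move=> acG; rewrite (reindex_onto induced_subgraph fst) /=; last first.
  by move=> H /andP[sH _]; rewrite -subtree_induced.
apply: eq_bigl => S; rewrite induced_subgraph_subtree eqxx andbT.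
by rewrite [in RHS]inE subsetT.
Qed.
End Subtrees.

Theorem lemma1p3 (V : finType) (T : sgraph V) (v : V) (hT : is_tree T) :
  let N_T : rat := (NT T)%:R in
  let R_T : rat := (RT T)%:R in
  let N_v : rat := (Nv T v)%:R in
  let R_v : rat := (Rv T v)%:R in
  3 * (N_T * R_v - N_v * R_T) >= N_T ^+ 2 - N_v * N_T
  /\ (3 * (N_T * R_v - N_v * R_T) >= N_T ^+ 2 - N_v * N_T
      <-> local_mean T v - global_mean T >= 1 / 3 * (N_T / N_v - 1)).
Proof.
case: hT => _ cT acT N_T R_T N_v R_v.
have cVT : connected_in T setT.
  apply: (connected_in_from (x := v)) => x _.
  have := cT v x; rewrite (@eq_connect _ T (induced T setT)) // => a b.
  by rewrite /induced /= !in_setT.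
have bnd : rooted_bounds N_v R_v N_T R_T.
  have := connected_sets_rooted_bounds acT cVT (in_setT v).
  have at_E f : (\sum_(S in connected_sets_at T setT v) f S
      = \sum_(H in subtrees_at T v) f H.1)%N.
    rewrite sum_connected_sets_at -big_mkcondr.
    rewrite -(sum_subtrees (fun S => v \in S)) //.
    by apply: eq_bigl => H; rewrite [RHS]inE.
  have E f : (\sum_(S in connected_sets T setT) f S
      = \sum_(H in subtrees T) f H.1)%N.
    by have := sum_subtrees xpredT f acT; rewrite !big_mkcondr.
  by rewrite !at_E !E !sum1_card.
have [_ nN _ _ _ main] := bnd; have n1 := rb_ge1 bnd.
split=> //; rewrite /local_mean /global_mean -/N_T -/R_T -/N_v -/R_v.
have n0 : 0 < N_v by lra.
have N0 : 0 < N_T by lra.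
suff -> : (1 / 3 * (N_T / N_v - 1) <= R_v / N_v - R_T / N_T)
  = (N_T ^+ 2 - N_v * N_T <= 3 * (N_T * R_v - N_v * R_T)) by [].
rewrite -[LHS]subr_ge0 -[RHS]subr_ge0.
have -> : R_v / N_v - R_T / N_T - 1 / 3 * (N_T / N_v - 1)
  = (3 * (N_T * R_v - N_v * R_T) - (N_T ^+ 2 - N_v * N_T)) / (3 * N_v * N_T).
  by field; rewrite !gt_eqF.
by rewrite pmulr_lge0 // invr_gt0 !mulr_gt0.
Qed.
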